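(* Let $(X,Y)$ follow the Haver-Winterstein distribution with parameters satisfying $0<\mu_2<0.5$ and $2\mu_2<k$. Then, as $y\to\infty$, $$\mathbb{P}(Y>y)=\exp\left\{-\frac{(\log y)^2}{2(\sigma_0+\sigma_1)}+O(\log y)\right\}.$$
   Context: The Haver-Winterstein distribution of $(X,Y)$ on $(0,\infty)^2$ is defined as follows. $X$ has density $$f_X(x)=\begin{cases}\frac{1}{\sqrt{2\pi}\,\alpha x}\exp\left\{-\frac{(\log x-\theta)^2}{2\alpha^2}\right\}, & 0<x\leq u,\\ \frac{k}{\lambda^k}x^{k-1}\exp\left\{-\left(\frac{x}{\lambda}\right)^k\right\}, & x>u,\end{cases}$$ where $u,\alpha,k,\lambda>0$ and $\theta\in\mathbb{R}$ are constrained so that $f_X$ is continuous at $u$ and integrates to $1$. Conditionally on $X=x$, $Y$ is log-normal with density $$f_{Y\mid X}(y\mid x)=\frac{1}{\sqrt{2\pi}\,\sigma(x)y}\exp\left\{-\frac{(\log y-\mu(x))^2}{2\sigma(x)^2}\right\},\quad x,y>0,$$ where $\mu(x)=\mu_0+\mu_1x^{\mu_2}$ and $\sigma(x)=\left[\sigma_0+\sigma_1\exp(-\sigma_2x)\right]^{1/2}$ with $\mu_0\in\mathbb{R}$ and $\mu_1,\mu_2,\sigma_0,\sigma_1,\sigma_2>0$. *)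

(* Defs.v *)
From HB Require Import structures.
From mathcomp Require Import all_boot all_order all_algebra.
From mathcomp Require Import all_classical all_reals all_analysis.

Set Implicit Arguments.
Unset Strict Implicit.
Unset Printing Implicit Defensive.

Import Order.TTheory GRing.Theory Num.Theory.
Import numFieldNormedType.Exports.

Local Open Scope classical_set_scope.
Local Open Scope ring_scope.

(* Needed for the big-O notation at +oo. *)
Canonical pinfty_filter_on (R : numFieldType) :=
  FilterType (pinfty_nbhs R) (@filter_filter _ _ (@proper_pinfty_nbhs R)).

(* Extended by zero to the nonpositive half-line, so that it is a density
   with respect to the Lebesgue measure on the whole line. *)
Definition lognormal_pdf (R : realType) (m s x : R) : R :=
  if 0 < x then
    (Num.sqrt (2 * pi) * s * x)^-1 * expR (- ((ln x - m) ^+ 2 / (2 * s ^+ 2)))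
  else 0.

(* Only used for x > 0. *)
Definition weibull_pdf (R : realType) (k lambda x : R) : R :=
  k / (lambda `^ k) * x `^ (k - 1) * expR (- ((x / lambda) `^ k)).

Record hw_param (R : realType) := HWParam {
  hw_u : R; hw_theta : R; hw_alpha : R; hw_k : R; hw_lambda : R;
  hw_mu0 : R; hw_mu1 : R; hw_mu2 : R;
  hw_sigma0 : R; hw_sigma1 : R; hw_sigma2 : R }.

Section haver_winterstein.
Context {R : realType}.
Variable p : hw_param R.

Definition hw_fX (x : R) : R :=
  if x <= hw_u p then lognormal_pdf (hw_theta p) (hw_alpha p) x
  else weibull_pdf (hw_k p) (hw_lambda p) x.

Definition hw_mu (x : R) : R := hw_mu0 p + hw_mu1 p * x `^ hw_mu2 p.

Definition hw_sigma (x : R) : R :=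
  Num.sqrt (hw_sigma0 p + hw_sigma1 p * expR (- hw_sigma2 p * x)).

(* The value for x <= 0 is irrelevant: X is almost surely positive. *)
Definition hw_fYX (y x : R) : R := lognormal_pdf (hw_mu x) (hw_sigma x) y.

Definition hw_admissible : Prop :=
  [/\ [/\ 0 < hw_u p, 0 < hw_alpha p, 0 < hw_k p & 0 < hw_lambda p],
      [/\ 0 < hw_mu1 p & 0 < hw_mu2 p],
      [/\ 0 < hw_sigma0 p, 0 < hw_sigma1 p & 0 < hw_sigma2 p],
      {for hw_u p, continuous hw_fX}
    & (\int[lebesgue_measure]_x (hw_fX x)%:E = 1)%E].

(* The second clause says that, for almost every x, the conditional law of Y
   given X = x has density hw_fYX ^~ x. *)
Definition follows_hw (d : measure_display) (T : measurableType d)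
    (P : probability T R) (X Y : {RV P >-> R}) : Prop :=
  (forall A : set R, measurable A ->
     distribution P X A = (\int[lebesgue_measure]_(x in A) (hw_fX x)%:E)%E) /\
  (forall A B : set R, measurable A -> measurable B ->
     P (X @^-1` A `&` Y @^-1` B) =
       (\int[distribution P X]_(x in A)
          \int[lebesgue_measure]_(y in B) (hw_fYX y x)%:E)%E).

End haver_winterstein.

(* Main.v *)
Require Import Defs.
From HB Require Import structures.
From mathcomp Require Import all_boot all_order all_algebra.
From mathcomp Require Import all_classical all_reals all_analysis.
From mathcomp Require Import measurable_realfun.
From mathcomp Require Import ring lra.

(* Write L = log y, S = sigma0 + sigma1, and let z = mu1 x^mu2 be the varying
   part of the conditional mean of log Y.

   Upper bound.  For x <= u both mu and sigma^2 are bounded, by b and S, so the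
   conditional tail is O(exp(-(L - b)^2 / (2 S))).  For x > u the conditional
   variance is at most some S' = S - D with D > 0, and the inequality
   (v + z)^2 / (S' + D) <= v^2 / S' + z^2 / D turns the conditional tail into
   O(exp(-(L - mu0)^2 / (2 S)) * exp(z^2 / (2 D))).  The last factor has finite
   expectation because z^2 is of order x^(2 mu2) and 2 mu2 < k, so the Weibull
   tail of X absorbs it.

   Lower bound.  Restrict to 1/(2L) < X <= 1/L and y < Y <= 2y.  There
   sigma(X)^2 = S - O(1/L), which costs only a factor exp(-O(L)), and the
   log-normal lower tail of X gives this event a probability of at least
   exp(-O((log L)^2)), well above exp(-O(L)). *)

Set Implicit Arguments.
Unset Strict Implicit.
Unset Printing Implicit Defensive.

Import Order.TTheory GRing.Theory Num.Theory.
Import numFieldNormedType.Exports.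

Local Open Scope classical_set_scope.
Local Open Scope ring_scope.

(** * Monotone integrals and integration against a density *)

Import HBNNSimple.

(* The nonnegative integral is a supremum over simple functions below the
   integrand, hence monotone even for nonmeasurable integrands. *)
Lemma ge0_le_integral_nonmeasurable (d : measure_display)
    (T : measurableType d) (R : realType) (mu : {measure set T -> \bar R})
    (D : set T) (f g : T -> \bar R) :
  (forall x, D x -> 0 <= f x)%E -> (forall x, D x -> f x <= g x)%E ->
  (\int[mu]_(x in D) f x <= \int[mu]_(x in D) g x)%E.
Proof.
move=> f0 fg; have g0 x : D x -> (0 <= g x)%E.
  by move=> Dx; apply: le_trans (f0 _ Dx) (fg _ Dx).
rewrite !ge0_integralE//; apply: le_ereal_sup => _ [h /= hf <-].
exists h => //= x; apply: (le_trans (hf x)).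
exact: lee_restrict.
Qed.

(** The standard extension argument: the density formula for sets gives the identity for indicators,
    finite sums give it for simple functions, and monotone convergence along an increasing
    approximation gives it for [g]. *)
Lemma integral_density (d : measure_display) (T : measurableType d)
    (R : realType) (mu nu : {measure set T -> \bar R}) (D : set T)
    (f : T -> R) (g : T -> \bar R) :
  measurable D -> measurable_fun D f -> (forall x, D x -> 0 <= f x) ->
  (forall A, measurable A -> A `<=` D -> nu A = \int[mu]_(x in A) (f x)%:E)%E ->
  measurable_fun D g -> (forall x, D x -> 0 <= g x)%E ->
  (\int[nu]_(x in D) g x = \int[mu]_(x in D) (g x * (f x)%:E))%E.
Proof.
move=> mD mf f0 nuE mg g0.
have simple (h : {nnsfun T >-> R}) :
    (\int[nu]_(x in D) (h x)%:E = \int[mu]_(x in D) ((h x)%:E * (f x)%:E))%E.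
  under eq_integral do rewrite fimfunE -fsumEFin//.
  rewrite ge0_integral_fsum//; last 2 first.
    by move=> r; apply: measurable_funTS;
      exact/measurable_EFinP/measurableT_comp.
    by move=> n x _; rewrite EFinM nnfun_muleindic_ge0.
  under [RHS]eq_integral => x xD.
    rewrite fimfunE -fsumEFin// ge0_mule_fsuml; last first.
      by move=> r; rewrite EFinM nnfun_muleindic_ge0.
    over.
  rewrite [RHS]ge0_integral_fsum//; last 2 first.
    move=> r; apply: emeasurable_funM; last exact/measurable_EFinP.
    apply: measurable_funTS.
    exact/measurable_EFinP/measurableT_comp.
    move=> n x Dx; apply: mule_ge0; last by rewrite lee_fin f0.
    by rewrite EFinM nnfun_muleindic_ge0.
  apply: eq_fsbigr => r /[!inE] rh.
  have r0 : 0 <= r by case: rh => x _ <-.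
rewrite integralZl_indic_nnsfun//.
  (* The indicator restricts the domain to a subset of [D], where [nuE] applies. *)
  rewrite integral_indic// nuE; [|exact: measurableI|by move=> x []].
  rewrite setIC integral_mkcondr -ge0_integralZl//; last 2 first.
     apply: (iffLR (measurable_restrict _ _ _)) => //.
    by apply: measurable_funS mD _ _; [exact: subIsetl|exact/measurable_EFinP].
    by move=> x Dx; rewrite patchE; case: ifP => // _; rewrite lee_fin f0.
  apply: eq_integral => x _; rewrite patchE indicE.
  by case: ifP => _; rewrite ?mulr1 ?mulr0 ?mule0 ?mul0e.
pose g_ := nnsfun_approx mD mg.
have gE (x : T) : D x -> (g_ n x)%:E @[n --> \oo] --> g x.
  by move=> Dx; exact: cvg_nnsfun_approx.
have ndg (x : T) : {homo (g_ ^~ x) : n m / (n <= m)%N >-> n <= m}.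
  by move=> n m nm; exact/lefP/nd_nnsfun_approx.
transitivity (limn (fun n => \int[nu]_(x in D) (g_ n x)%:E)%E).
  rewrite -monotone_convergence//=.
  - by apply: eq_integral => x /[!inE] xD; apply/esym/cvg_lim => //; exact: gE.
  - by move=> n; exact/measurable_EFinP/measurable_funTS.
  - by move=> n ? _; rewrite lee_fin.
  - by move=> ? _ ? ? mn; rewrite lee_fin; exact: ndg.
under eq_fun do rewrite simple.
rewrite -monotone_convergence//=.
- apply: eq_integral => x /[!inE] xD; apply/cvg_lim => //.
  by apply: cvgeZr => //; exact: gE.
- by move=> n; apply: emeasurable_funM; apply/measurable_EFinP => //;
    exact: measurable_funTS.
- by move=> n x Dx; rewrite mule_ge0 ?lee_fin ?f0// lee_fin.
- by move=> x Dx ? ? mn; apply: lee_wpmul2r; rewrite lee_fin ?f0//; exact: ndg.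
Qed.

(** * The integral of x^-2 over a half-line *)

Lemma continuous_inv_sqr (R : realType) (x : R) :
  x != 0 -> {for x, continuous (fun x : R => x ^- 2)}.
Proof.
move=> x0; apply: continuousV; first by rewrite expf_neq0.
exact: exprn_continuous.
Qed.

Lemma measurable_inv_sqr (R : realType) (a : R) :
  0 <= a -> measurable_fun `]a, +oo[ (fun x : R => x ^- 2).
Proof.
move=> a0; apply: open_continuous_measurable_fun => // x.
rewrite inE/= in_itv/= andbT => ax; apply: continuous_inv_sqr.
by rewrite gt_eqF// (le_lt_trans a0).
Qed.

(** The antiderivative is -1/x, which vanishes at infinity. The null endpoint [a] is added first so
    that the fundamental theorem of calculus applies on a closed half-line. *)
Lemma integral_inv_sqr (R : realType) (a : R) : 0 < a ->
  (\int[lebesgue_measure]_(x in `]a, +oo[) (x ^- 2)%:E = a^-1%:E)%E.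
Proof.
move=> a0.
have dF (x : R) : a <= x -> is_derive x 1 (fun x : R => - x^-1) (x ^- 2).
  move=> ax; have x0 : x != 0 by rewrite gt_eqF// (lt_le_trans a0).
  apply: is_derive_eq.
    by apply: is_deriveN; apply: is_deriveV.
  by rewrite -mulNr opprK /= mulr1.
have cF (x : R) : a <= x -> {for x, continuous (fun x : R => - x^-1)}.
  move=> ax; apply: differentiable_continuous; apply/derivable1_diffP.
  by have [] := dF _ ax.
rewrite integral_itv_obnd_cbnd//; last first.
  by apply/measurable_EFinP; apply: measurable_inv_sqr; exact: ltW.
rewrite (@ge0_continuous_FTC2y _ _ (fun x => - x^-1) a 0)//.
- by rewrite EFinN oppeK add0e.
- by move=> x ax; rewrite invr_ge0 sqr_ge0.
- apply: continuous_in_subspaceT => x; rewrite inE/= in_itv/= andbT => ax.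
  by apply: continuous_inv_sqr; rewrite gt_eqF// (lt_le_trans a0).
- rewrite -oppr0; apply: cvgN.
  by apply/gtr0_cvgV0; [exact: nbhs_pinfty_gt|exact: cvg_id].
- by move=> x /ltW /dF[].
- by apply: cvg_at_right_filter; exact: cF.
- by move=> x; rewrite in_itv/= andbT => /ltW/dF ?;
    rewrite derive1E; exact: derive_val.
Qed.

(** * Log-normal tails *)

Lemma lognormal_pdf_ge0 (R : realType) (m s x : R) :
  0 <= s -> 0 <= lognormal_pdf m s x.
Proof.
move=> s0; rewrite /lognormal_pdf; case: ifPn => // x0.
by rewrite mulr_ge0 ?expR_ge0// invr_ge0 !mulr_ge0 ?sqrtr_ge0// ltW.
Qed.

(* With w = ln t - ln y >= 0, the bound w^2 / (2 V) >= w - V / 2 replaces the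
   Gaussian in ln t by y / t, leaving the elementary integral of y / t^2. *)
Lemma integral_lognormal_tail_le (R : realType) (m s b V r y : R) :
  0 < s -> 0 < V -> 0 < y -> b <= ln y ->
  (forall t, y < t ->
    (ln t - b) ^+ 2 / (2 * V) - r <= (ln t - m) ^+ 2 / (2 * s ^+ 2)) ->
  (\int[lebesgue_measure]_(t in `]y, +oo[) (lognormal_pdf m s t)%:E <=
   ((Num.sqrt (2 * pi) * s)^-1 *
    expR (r + V / 2 - (ln y - b) ^+ 2 / (2 * V)))%:E)%E.
Proof.
move=> s0 V0 y0 by_ tail.
set G := (X in (_ <= X%:E)%E).
have c0 : 0 < Num.sqrt (2 * pi) * s :> R.
  by rewrite mulr_gt0// sqrtr_gt0 mulr_gt0// pi_gt0.
have G0 : 0 <= G by rewrite mulr_ge0 ?expR_ge0// invr_ge0 ltW.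
apply: (@le_trans _ _
    (\int[lebesgue_measure]_(t in `]y, +oo[) ((G * y)%:E * (t ^- 2)%:E)))%E.
  apply: ge0_le_integral_nonmeasurable => t; rewrite /= in_itv/= andbT => yt.
    by rewrite lee_fin lognormal_pdf_ge0// ltW.
  have t0 : 0 < t by exact: lt_trans yt.
  rewrite -EFinM lee_fin.
  have -> : G * y * t ^- 2 = (Num.sqrt (2 * pi) * s * t)^-1 *
      expR (r + V / 2 - (ln y - b) ^+ 2 / (2 * V) - (ln t - ln y)).
    rewrite /G [in RHS]expRD opprB (expRB (ln y)) !lnK ?posrE//.
    by field; rewrite !gt_eqF// sqrtr_gt0 mulr_gt0// pi_gt0.
  rewrite /lognormal_pdf t0 ler_pM2l; last by rewrite invr_gt0 mulr_gt0.
  rewrite ler_expR.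
  have yt' : ln y <= ln t by rewrite ler_ln ?posrE// ltW.
  have := tail _ yt.
  suff : (ln y - b) ^+ 2 / (2 * V) + (ln t - ln y) - V / 2
         <= (ln t - b) ^+ 2 / (2 * V) by lra.
  rewrite -subr_ge0.
  (* Completing the square in w = ln t - ln y leaves the cross term 2 (ln y - b) w, nonnegative
     because b <= ln y. *)
  have -> : (ln t - b) ^+ 2 / (2 * V) -
      ((ln y - b) ^+ 2 / (2 * V) + (ln t - ln y) - V / 2) =
      (2 * (ln y - b) * (ln t - ln y) + (ln t - ln y - V) ^+ 2) / (2 * V).
    by field; rewrite gt_eqF.
  apply: divr_ge0; last by lra.
  by apply: addr_ge0; rewrite ?sqr_ge0// !mulr_ge0 ?subr_ge0.
rewrite ge0_integralZl//=.
- by rewrite integral_inv_sqr// -EFinM -mulrA divff ?mulr1// gt_eqF.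
- by apply/measurable_EFinP; apply: measurable_inv_sqr; exact: ltW.
- by move=> t _; rewrite lee_fin invr_ge0 sqr_ge0.
- by rewrite lee_fin mulr_ge0// ltW.
Qed.

(** * Weibull decay against exponentials of lower powers *)

(** The two powers x^e and eps x^k cross at ln x = [T]. Up to there x^e is at most its value at the
    crossing, and afterwards eps x^k dominates. *)
Lemma powR_lt_exponent (R : realType) (e k eps : R) : 0 <= e < k -> 0 < eps ->
  exists2 C, 0 <= C & forall x, 0 < x -> x `^ e <= C + eps * x `^ k.
Proof.
move=> /andP[e0 ek] eps0; pose T := - ln eps / (k - e).
exists (expR (e * T)); first exact: expR_ge0.
move=> x x0; rewrite /powR gt_eqF//.
have [xT|Tx] := leP (ln x) T.
  apply: (@le_trans _ _ (expR (e * T))); first by rewrite ler_expR ler_wpM2l.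
  by rewrite lerDl mulr_ge0 ?expR_ge0// ltW.
apply: (@le_trans _ _ (eps * expR (k * ln x))); last by rewrite lerDr expR_ge0.
rewrite -{1}(@lnK _ eps) ?posrE// -expRD ler_expR.
move: Tx; rewrite /T ltr_pdivrMr ?subr_gt0// => Tx.
by rewrite -subr_ge0; lra.
Qed.

(** This is 1 + s <= exp s at s = k ln x + ln del, multiplied by c / k; [del] is chosen so that the
    coefficient of x^k becomes eps. *)
Lemma ln_le_powR (R : realType) (c k eps : R) : 0 < k -> 0 < eps -> 0 < c ->
  exists C, forall x, 0 < x -> c * ln x <= C + eps * x `^ k.
Proof.
move=> k0 eps0 c0; pose del := eps * k / c.
have del0 : 0 < del by rewrite divr_gt0// mulr_gt0.
exists (- (c / k * (1 + ln del))) => x x0; rewrite /powR gt_eqF//.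
have := expR_ge1Dx (k * ln x + ln del).
rewrite expRD lnK ?posrE// => h.
have -> : eps = c / k * del by rewrite /del; field; rewrite !gt_eqF.
have -> : c * ln x = c / k * (k * ln x) by field; rewrite gt_eqF.
have := ler_wpM2l (ltW (divr_gt0 c0 k0)) h.
set a := c / k; lra.
Qed.

(** The Weibull exponent is -A x^k. One half of it absorbs q x^e, the other half absorbs (k + 1) ln
    x, which comes from x^(k - 1) and the target x^-2. Dividing by 2 (q + 1) instead of 2 q also
    covers q = 0. *)
Lemma weibull_pdf_mul_expR_powR_le (R : realType) (k lam q e : R) :
  0 < k -> 0 < lam -> 0 <= q -> 0 <= e < k ->
  exists2 C, 0 <= C & forall x, 0 < x ->
    weibull_pdf k lam x * expR (q * x `^ e) <= C * x ^- 2.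
Proof.
move=> k0 lam0 q0 ek; pose A := (lam^-1) `^ k.
have A0 : 0 < A by rewrite powR_gt0// invr_gt0.
have q1 : 0 < 2 * (q + 1) by lra.
have [C1 C10 le1] :=
  @powR_lt_exponent _ e k (A / (2 * (q + 1))) ek (divr_gt0 A0 q1).
have [C2 le2] :=
  @ln_le_powR _ (k + 1) k (A / 2) k0 (divr_gt0 A0 (ltr0n _ 2))
    (addr_gt0 k0 ltr01).
have kl : 0 <= k / lam `^ k by rewrite divr_ge0 ?powR_ge0// ltW.
exists (k / lam `^ k * expR (q * C1 + C2)); first by rewrite mulr_ge0 ?expR_ge0.
move=> x x0; rewrite /weibull_pdf -!mulrA ler_wpM2l//.
  by rewrite ltW.
rewrite ler_wpM2l ?invr_ge0 ?powR_ge0//.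
rewrite powRM; [|exact: ltW|by rewrite invr_ge0 ltW]; rewrite -/A.
have -> : x ^- 2 = expR (- (2 * ln x)).
  by rewrite expRN expRM_natl lnK ?posrE.
rewrite {1}/powR gt_eqF// -!expRD. rewrite ler_expR.
have := ler_wpM2l q0 (le1 _ x0); have := le2 _ x0.
have : q * (A / (2 * (q + 1)) * x `^ k) <= A / 2 * x `^ k.
  rewrite mulrA ler_wpM2r ?powR_ge0//.
  rewrite -subr_ge0.
  have -> : A / 2 - q * (A / (2 * (q + 1))) = A / (2 * (q + 1)) by field; lra.
  by rewrite divr_ge0// ltW.
rewrite mulrDr (mulrC (x `^ k)).
set w := x `^ k; set z := x `^ e; set t := ln x.
lra.
Qed.

(** * Upper bounds for the conditional tail of Y given X = x *)

Lemma hw_sigma_sqr (R : realType) (p : hw_param R) (x : R) :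
  0 <= hw_sigma0 p -> 0 <= hw_sigma1 p ->
  hw_sigma p x ^+ 2 = hw_sigma0 p + hw_sigma1 p * expR (- hw_sigma2 p * x).
Proof.
by move=> s0 s1; rewrite sqr_sqrtr// addr_ge0// mulr_ge0// expR_ge0.
Qed.

Lemma hw_sigma_ge (R : realType) (p : hw_param R) (x : R) :
  0 <= hw_sigma1 p -> Num.sqrt (hw_sigma0 p) <= hw_sigma p x.
Proof. by move=> s1; rewrite ler_wsqrtr// lerDl mulr_ge0// expR_ge0. Qed.

(** Reduces both ranges of x to a comparison of Gaussian exponents with loss [r]. Since sigma(x)^2
    >= sigma0, the prefactor can be made independent of x. *)
Lemma hw_tail_le (R : realType) (p : hw_param R) (b r x y : R) :
  0 < hw_sigma0 p -> 0 < hw_sigma1 p -> 0 < y -> b <= ln y ->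
  (forall t, y < t -> (ln t - b) ^+ 2 / (2 * (hw_sigma0 p + hw_sigma1 p)) - r <=
    (ln t - hw_mu p x) ^+ 2 / (2 * hw_sigma p x ^+ 2)) ->
  (\int[lebesgue_measure]_(t in `]y, +oo[) (hw_fYX p t x)%:E <=
   ((Num.sqrt (2 * pi) * Num.sqrt (hw_sigma0 p))^-1 *
    expR (r + (hw_sigma0 p + hw_sigma1 p) / 2 -
          (ln y - b) ^+ 2 / (2 * (hw_sigma0 p + hw_sigma1 p))))%:E)%E.
Proof.
move=> s0 s1 y0 by_ tail.
have sg : 0 < hw_sigma p x.
  by apply: lt_le_trans _ (hw_sigma_ge x (ltW s1)); rewrite sqrtr_gt0.
apply: le_trans (integral_lognormal_tail_le _ _ _ _ tail) _ => //.
  exact: addr_gt0.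
have c0 : 0 < Num.sqrt (2 * pi) :> R by rewrite sqrtr_gt0 mulr_gt0// pi_gt0.
rewrite lee_fin ler_wpM2r ?expR_ge0// lef_pV2 ?posrE;
  [|exact: mulr_gt0|by rewrite mulr_gt0// sqrtr_gt0].
by rewrite ler_pM2l// hw_sigma_ge// ltW.
Qed.

Lemma hw_tail_le_small (R : realType) (p : hw_param R) (x y : R) :
  hw_admissible p -> 0 < x -> x <= hw_u p -> 0 < y ->
  let b := hw_mu0 p + hw_mu1 p * hw_u p `^ hw_mu2 p in
  let S := hw_sigma0 p + hw_sigma1 p in
  b <= ln y ->
  (\int[lebesgue_measure]_(t in `]y, +oo[) (hw_fYX p t x)%:E <=
   ((Num.sqrt (2 * pi) * Num.sqrt (hw_sigma0 p))^-1 *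
    expR (S / 2 - (ln y - b) ^+ 2 / (2 * S)))%:E)%E.
Proof.
move=> [[u0 _ _ _] [m10 m20] [s0 s1 s2] _ _] x0 xu y0 b S by_.
rewrite -(add0r (S / 2)); apply: hw_tail_le => // t yt; rewrite subr0.
have t0 : 0 < t := lt_trans y0 yt.
have yt' : ln y <= ln t by rewrite ler_ln ?posrE// ltW.
have bt : b <= ln t := le_trans by_ yt'.
have mub : hw_mu p x <= b.
  by rewrite /hw_mu /b lerD2l ler_pM2l// ge0_ler_powR// ?nnegrE ltW.
have sS : hw_sigma p x ^+ 2 <= S.
  rewrite (hw_sigma_sqr _ (ltW s0) (ltW s1)) /S lerD2l ler_piMr ?expR_le1//;
    first exact: ltW.
  by rewrite mulNr oppr_le0 mulr_ge0 ?ltW.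
have sg : 0 < hw_sigma p x ^+ 2.
  by rewrite (hw_sigma_sqr _ (ltW s0) (ltW s1)) addr_gt0 ?mulr_gt0 ?expR_gt0.
apply: ler_pM; rewrite ?sqr_ge0 ?invr_ge0//.
- by rewrite mulr_ge0// addr_ge0 ?ltW.
- by rewrite ler_sqr ?nnegrE ?subr_ge0 ?(le_trans mub)// lerD2l lerN2.
- have S0 : 0 < S by exact: addr_gt0.
  by rewrite lef_pV2 ?posrE; [rewrite ler_pM2l|lra|lra].
Qed.

Lemma hw_tail_le_large (R : realType) (p : hw_param R) (x y : R) :
  hw_admissible p -> hw_u p < x ->
  let S := hw_sigma0 p + hw_sigma1 p in
  let D := hw_sigma1 p * (1 - expR (- hw_sigma2 p * hw_u p)) in
  0 < y -> hw_mu0 p <= ln y ->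
  (\int[lebesgue_measure]_(t in `]y, +oo[) (hw_fYX p t x)%:E <=
   ((Num.sqrt (2 * pi) * Num.sqrt (hw_sigma0 p))^-1 *
    expR ((hw_mu1 p * x `^ hw_mu2 p) ^+ 2 / (2 * D) + S / 2 -
          (ln y - hw_mu0 p) ^+ 2 / (2 * S)))%:E)%E.
Proof.
move=> [[u0 _ _ _] [m10 m20] [s0 s1 s2] _ _] ux S D y0 by_.
apply: hw_tail_le => // t yt.
(* [S'] is sigma(u)^2, which bounds the conditional variance for x > u because sigma decreases. *)
pose S' := S - D.
have D0 : 0 < D.
  by rewrite mulr_gt0// subr_gt0 expR_lt1 mulNr oppr_lt0 mulr_gt0.
have S'E : S' = hw_sigma0 p + hw_sigma1 p * expR (- hw_sigma2 p * hw_u p).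
  by rewrite /S' /S /D; ring.
have S'0 : 0 < S' by rewrite S'E addr_gt0// mulr_gt0 ?expR_gt0.
have sg : 0 < hw_sigma p x ^+ 2.
  by rewrite (hw_sigma_sqr _ (ltW s0) (ltW s1)) addr_gt0 ?mulr_gt0 ?expR_gt0.
have sS : hw_sigma p x ^+ 2 <= S'.
  rewrite S'E (hw_sigma_sqr _ (ltW s0) (ltW s1)) lerD2l ler_pM2l// ler_expR.
  rewrite !mulNr lerN2.
  by rewrite ler_pM2l// ltW.
set z := hw_mu1 p * x `^ hw_mu2 p; rewrite /hw_mu -/z -/S.
apply: (@le_trans _ _ ((ln t - (hw_mu0 p + z)) ^+ 2 / (2 * S'))); last first.
  rewrite ler_wpM2l ?sqr_ge0// lef_pV2 ?posrE; [|lra|lra].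
  by rewrite ler_pM2l.
have -> : S = S' + D by rewrite /S'; ring.
rewrite -subr_ge0.
set v := ln t - hw_mu0 p.
(* The gap in the quadratic inequality is exactly a square over a positive denominator. *)
have -> : (ln t - (hw_mu0 p + z)) ^+ 2 / (2 * S') -
    (v ^+ 2 / (2 * (S' + D)) - z ^+ 2 / (2 * D)) =
    (D * (v - z) - S' * z) ^+ 2 / (2 * (S' * D * (S' + D))).
  by rewrite opprD addrA -/v; field; rewrite !gt_eqF// addr_gt0.
apply: divr_ge0; [exact: sqr_ge0|apply: mulr_ge0 => //; apply: ltW].
exact: mulr_gt0 (mulr_gt0 S'0 D0) (addr_gt0 S'0 D0).
Qed.

(** * The law of X and its exponential moments beyond u *)

Lemma hw_fX_ge0 (R : realType) (p : hw_param R) (x : R) :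
  hw_admissible p -> 0 <= hw_fX p x.
Proof.
move=> [[u0 a0 k0 l0] _ _ _ _]; rewrite /hw_fX; case: ifPn => _.
  by rewrite lognormal_pdf_ge0// ltW.
rewrite /weibull_pdf; apply: mulr_ge0; last exact: expR_ge0.
by rewrite mulr_ge0 ?powR_ge0// divr_ge0 ?powR_ge0// ltW.
Qed.

Lemma measurable_weibull_pdf (R : realType) (k lam : R) (D : set R) :
  measurable D -> measurable_fun D (weibull_pdf k lam).
Proof.
move=> mD; apply: measurable_funTS.
apply: measurable_funM.
  by apply: measurable_funM => //; exact: measurable_powR.
apply: measurableT_comp => //; apply: measurableT_comp => //.
apply: (measurableT_comp (measurable_powR _)).
exact: measurable_funM.
Qed.

Lemma hw_fYX_ge0 (R : realType) (p : hw_param R) (x y : R) : 0 <= hw_fYX p y x.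
Proof. by rewrite lognormal_pdf_ge0// sqrtr_ge0. Qed.

Lemma integral_distribution_density (R : realType) (d : measure_display)
    (T : measurableType d) (P : probability T R) (X : {RV P >-> R})
    (D : set R) (f : R -> R) (g : R -> \bar R) :
  measurable D -> measurable_fun D f -> (forall x, D x -> 0 <= f x) ->
  (forall A, measurable A ->
    distribution P X A = \int[lebesgue_measure]_(x in A) (f x)%:E)%E ->
  measurable_fun D g -> (forall x, D x -> 0 <= g x)%E ->
  (\int[distribution P X]_(x in D) g x =
   \int[lebesgue_measure]_(x in D) (g x * (f x)%:E))%E.
Proof.
move=> mD mf f0 fE mg g0.
(* [lebesgue_measure] lives on [measurableTypeR R], whose display differs from
   that of the canonical measurable structure of [R]. *)
pose X_ : T -> measurableTypeR R := X.
have mX_ : measurable_fun setT X_ by exact: measurable_funPT X.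
pose X' : {RV P >-> measurableTypeR R} :=
  HB.pack X_ (isMeasurableFun.Build _ _ _ _ X_ mX_).
rewrite -(@integral_density _ _ _ _ (distribution P X'))//; last first.
  by move=> A mA _; rewrite -fE.
rewrite [RHS]ge0_integral_pushforward//; last by move=> x /[!inE]; exact: g0.
by rewrite ge0_integral_pushforward// => x /[!inE]; exact: g0.
Qed.

(** Beyond u the density is Weibull, so the integrand against Lebesgue measure is at most C x^-2,
    whose integral is C / u. *)
Lemma hw_X_exp_moment (R : realType) (d : measure_display)
    (T : measurableType d) (P : probability T R) (X Y : {RV P >-> R})
    (p : hw_param R) (q e : R) :
  hw_admissible p -> follows_hw p X Y -> 0 <= q -> 0 <= e < hw_k p ->
  exists2 M : R, 0 <= M &
  (\int[distribution P X]_(x in `]hw_u p, +oo[) (expR (q * x `^ e))%:E <=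
   M%:E)%E.
Proof.
move=> hp [hX _] q0 ek.
have [[u0 a0 k0 l0] _ _ _ _] := hp.
have [C C0 CE] := weibull_pdf_mul_expR_powR_le k0 l0 q0 ek.
have fE : {in `]hw_u p, +oo[%classic,
    hw_fX p =1 weibull_pdf (hw_k p) (hw_lambda p)}.
  by move=> x; rewrite inE/= in_itv/= andbT /hw_fX leNgt => ->.
exists (C * (hw_u p)^-1); first by rewrite mulr_ge0 ?invr_ge0// ltW.
have mf : measurable_fun `]hw_u p, +oo[ (hw_fX p).
  apply: (eq_measurable_fun (weibull_pdf (hw_k p) (hw_lambda p))).
    by move=> x /fE.
  exact: measurable_weibull_pdf.
have -> : (\int[distribution P X]_(x in `]hw_u p, +oo[) (expR (q * x `^ e))%:E =
    \int[lebesgue_measure]_(x in `]hw_u p, +oo[)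
      ((expR (q * x `^ e))%:E * (hw_fX p x)%:E))%E.
  apply: integral_distribution_density => //.
  - by move=> x _; rewrite hw_fX_ge0.
  - apply/measurable_EFinP; apply: measurable_funTS.
    apply: measurableT_comp => //; apply: measurable_funM => //.
rewrite EFinM -integral_inv_sqr//.
rewrite -ge0_integralZl//=; last 2 first.
  by apply/measurable_EFinP; apply: measurable_inv_sqr; exact: ltW.
  by move=> x _; rewrite lee_fin invr_ge0 sqr_ge0.
apply: ge0_le_integral_nonmeasurable => x ux.
  by rewrite -EFinM lee_fin mulr_ge0 ?expR_ge0// hw_fX_ge0.
rewrite -!EFinM lee_fin mulrC fE ?inE//; apply: CE.
by move: ux; rewrite /= in_itv/= andbT; exact: lt_trans.
Qed.

(** * Upper bound for the survival function of Y *)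

Lemma hw_survival_le (R : realType) (d : measure_display)
    (T : measurableType d) (P : probability T R) (X Y : {RV P >-> R})
    (p : hw_param R) :
  hw_admissible p -> follows_hw p X Y -> 2 * hw_mu2 p < hw_k p ->
  let S := hw_sigma0 p + hw_sigma1 p in
  exists C b1 b2 : R, 0 <= C /\ forall y, 0 < y -> b1 <= ln y -> b2 <= ln y ->
   (P [set w | (y < Y w)%R] <=
     (C * expR (- ((ln y - b1) ^+ 2 / (2 * S))))%:E +
     (C * expR (- ((ln y - b2) ^+ 2 / (2 * S))))%:E)%E.
Proof.
move=> hp hXY hk S; have [hX hXYd] := hXY.
have [[u0 a0 k0 l0] [m10 m20] [s0 s1 s2] _ _] := hp.
pose D := hw_sigma1 p * (1 - expR (- hw_sigma2 p * hw_u p)).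
have D0 : 0 < D.
  by rewrite mulr_gt0// subr_gt0 expR_lt1 mulNr oppr_lt0 mulr_gt0.
(* Chosen so that q x^(2 mu2) is the loss (mu1 x^mu2)^2 / (2 D) in the tail bound for x > u. *)
pose q := hw_mu1 p ^+ 2 / (2 * D).
have q0 : 0 <= q by apply: divr_ge0; [exact: sqr_ge0|rewrite pmulr_rge0// ltW].
have e0 : 0 <= hw_mu2 p * 2 < hw_k p by rewrite mulr_ge0 ?ltW//= mulrC.
have [M M0 hM] := hw_X_exp_moment hp hXY q0 e0.
pose c0 := (Num.sqrt (2 * pi) * Num.sqrt (hw_sigma0 p))^-1.
have c00 : 0 <= c0 by rewrite invr_ge0 mulr_ge0 ?sqrtr_ge0.
(* The factor 1 + M serves both ranges of X: it exceeds the mass of (0, u], at most 1, and the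
   moment bound M beyond u. *)
pose C := c0 * expR (S / 2) * (1 + M).
pose b := hw_mu0 p + hw_mu1 p * hw_u p `^ hw_mu2 p.
have C00 : 0 <= c0 * expR (S / 2) by rewrite mulr_ge0 ?expR_ge0.
exists C, b, (hw_mu0 p); split; first by rewrite mulr_ge0// addr_ge0.
move=> y y0 by1 by2.
pose B := `]y, +oo[%classic : set R.
have mX A : measurable A -> measurable (X @^-1` A).
  by move=> mA; rewrite -[X in measurable X]setTI; exact: measurable_funPT.
have mY A : measurable A -> measurable (Y @^-1` A).
  by move=> mA; rewrite -[X in measurable X]setTI; exact: measurable_funPT.
have BE : [set w | y < Y w] = Y @^-1` B.
  by rewrite /B; apply/seteqP; split=> w; rewrite /= in_itv/= andbT.
have mB : measurable (Y @^-1` B) by apply: mY; exact: measurable_itv.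
pose X0 := X @^-1` `]-oo, 0%R].
pose X1 := X @^-1` `]0%R, hw_u p] `&` Y @^-1` B.
pose X2 := X @^-1` `]hw_u p, +oo[ `&` Y @^-1` B.
have mX0 : measurable X0 by exact: mX.
have mX1 : measurable X1 by apply: measurableI; [exact: mX|exact: mB].
have mX2 : measurable X2 by apply: measurableI; [exact: mX|exact: mB].
have cover : Y @^-1` B `<=` X0 `|` (X1 `|` X2).
  move=> w Bw; rewrite /X0 /X1 /X2 /= !in_itv/= andbT.
  have [|?] := leP (X w) 0; [by left|right].
  by have [|] := leP (X w) (hw_u p); [left|right].
(* The density of X vanishes on the nonpositive half-line. *)
have P0 : P X0 = 0%E.
  rewrite -[LHS]/(distribution P X _) hX// integral0_eq// => x.
  rewrite /= in_itv/= => x0; rewrite /hw_fX (le_trans x0 (ltW u0)).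
  by rewrite /lognormal_pdf ltNge x0.
rewrite BE.
apply: le_trans (_ : _ <= P (X0 `|` (X1 `|` X2)))%E _.
  by apply: le_measure; rewrite ?inE;
    [exact: mB|do 2 apply: measurableU => //|].
apply: le_trans (measureU2 _ mX0 (measurableU _ _ mX1 mX2)) _.
rewrite [X in (X + _)%E]P0 add0e.
apply: le_trans (measureU2 _ mX1 mX2) _.
apply: leeD.
- rewrite [leLHS](hXYd _ _ (measurable_itv _) (measurable_itv _)).
  apply: (@le_trans _ _ (\int[distribution P X]_(x in `]0%R, hw_u p])
    (cst (c0 * expR (S / 2) * expR (- ((ln y - b) ^+ 2 / (2 * S))))%:E x)))%E.
    apply: ge0_le_integral_nonmeasurable => x;
      rewrite /= in_itv/= => /andP[x0 xu].
      by apply: integral_ge0 => t _; rewrite lee_fin hw_fYX_ge0.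
    apply: le_trans (hw_tail_le_small hp x0 xu y0 by1) _.
    by rewrite lee_fin -mulrA -expRD.
  rewrite integral_cst// -[leRHS]mule1.
  apply: lee_pmul; rewrite ?lee_fin.
  + by rewrite mulr_ge0 ?expR_ge0.
  + exact: measure_ge0.
  + by rewrite ler_wpM2r ?expR_ge0// ler_peMr// lerDl.
  + by apply: probability_le1; exact: measurable_itv.
- rewrite [leLHS](hXYd _ _ (measurable_itv _) (measurable_itv _)).
  pose c := c0 * expR (S / 2) * expR (- ((ln y - hw_mu0 p) ^+ 2 / (2 * S))).
  apply: (@le_trans _ _ (\int[distribution P X]_(x in `]hw_u p, +oo[)
    (c%:E * (expR (q * x `^ (hw_mu2 p * 2)))%:E)))%E.
    apply: ge0_le_integral_nonmeasurable => x; rewrite /= in_itv/= andbT => ux.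
      by apply: integral_ge0 => t _; rewrite lee_fin hw_fYX_ge0.
    apply: le_trans (hw_tail_le_large hp ux y0 by2) _.
    rewrite -EFinM lee_fin /c -[leRHS]mulrA -expRD -[leRHS]mulrA -expRD.
    apply: ler_wpM2l => //; rewrite ler_expR.
    rewrite powRrM powR_mulrn ?powR_ge0// exprMn -/D -/S /q.
    set z := x `^ _ ^+ 2; set w := _ ^+ 2 / (2 * S); lra.
  have c0' : 0 <= c by rewrite mulr_ge0 ?expR_ge0.
  rewrite ge0_integralZl//=; last first.
    apply/measurable_EFinP; apply: measurable_funTS.
    by apply: measurableT_comp => //; apply: measurable_funM.
  apply: le_trans (lee_wpmul2l _ hM) _; first by rewrite lee_fin.
  rewrite -EFinM lee_fin /c /C mulrAC ler_wpM2r ?expR_ge0//.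
  by rewrite ler_wpM2l// lerDr.
Qed.

(** * Lower bound for the survival function of Y *)

(** Square ln x = 2 ln (sqrt x) <= 2 sqrt x. *)
Lemma sqr_ln_le (R : realType) (x : R) : 1 <= x -> ln x ^+ 2 <= 4 * x.
Proof.
move=> x1; have x0 : 0 < x by exact: lt_le_trans x1.
have sx : 0 < Num.sqrt x by rewrite sqrtr_gt0.
have lx : ln x = 2 * ln (Num.sqrt x).
  by rewrite -{1}(sqr_sqrtr (ltW x0)) lnXn// mulr_natl.
rewrite -{2}(sqr_sqrtr (ltW x0)) -[4]/((2 * 2)%:R) natrM -expr2 -exprMn.
rewrite ler_sqr ?nnegrE ?ln_ge0// ?mulr_ge0 ?sqrtr_ge0//.
by rewrite lx ler_wpM2l// ltW// ln_sublinear.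
Qed.

(** On this window |ln x| <= ln (2 L), and (ln (2 L))^2 is crudely replaced by 8 L, since a loss
    linear in L is affordable. The cross term is handled by (a - b)^2 <= 2 a^2 + 2 b^2. *)
Lemma hw_fX_ge (R : realType) (p : hw_param R) (L x : R) :
  0 < hw_alpha p -> 1 <= L -> L^-1 <= hw_u p -> (2 * L)^-1 < x -> x <= L^-1 ->
  (Num.sqrt (2 * pi) * hw_alpha p)^-1 * L *
    expR (- ((8 * L + hw_theta p ^+ 2) / hw_alpha p ^+ 2)) <= hw_fX p x.
Proof.
move=> a0 L1 Lu Lx xL.
have L0 : 0 < L by exact: lt_le_trans L1.
have x0 : 0 < x by apply: lt_trans Lx; rewrite invr_gt0 mulr_gt0.
have x1 : x <= 1 by apply: le_trans xL _; rewrite invf_le1.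
have c0 : 0 < Num.sqrt (2 * pi) :> R by rewrite sqrtr_gt0 mulr_gt0// pi_gt0.
rewrite /hw_fX (le_trans xL Lu) /lognormal_pdf x0.
apply: ler_pM.
- by rewrite mulr_ge0 ?invr_ge0 ?mulr_ge0// ltW.
- exact: expR_ge0.
- rewrite [leRHS]invfM; apply: ler_wpM2l.
    by rewrite invr_ge0 mulr_ge0// ltW.
  have : L^-1 ^-1 <= x^-1 by rewrite lef_pV2 ?posrE ?invr_gt0.
  by rewrite invrK.
rewrite ler_expR lerN2.
have h : ln x ^+ 2 <= 4 * (2 * L).
  have L2 : 1 <= 2 * L by lra.
  apply: le_trans (sqr_ln_le L2).
  rewrite -sqrrN ler_sqr ?nnegrE ?oppr_ge0 ?ln_le0// ?ln_ge0//.
  rewrite -lnV ?posrE// ler_ln ?posrE ?invr_gt0 ?mulr_gt0//.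
  have : x^-1 <= (2 * L)^-1 ^-1.
    by rewrite lef_pV2 ?posrE ?invr_gt0 ?mulr_gt0// ltW.
  by rewrite invrK.
have -> : (8 * L + hw_theta p ^+ 2) / hw_alpha p ^+ 2 =
    (2 * (8 * L + hw_theta p ^+ 2)) / (2 * hw_alpha p ^+ 2).
  by field; rewrite gt_eqF.
apply: ler_wpM2r; first by rewrite invr_ge0 pmulr_rge0// sqr_ge0.
have h2 := sqr_ge0 (ln x + hw_theta p).
lra.
Qed.

Lemma hw_fYX_ge (R : realType) (p : hw_param R) (x y t : R) :
  hw_admissible p -> 0 < y -> 1 <= ln y -> hw_mu0 p + hw_mu1 p <= ln y ->
  let S := hw_sigma0 p + hw_sigma1 p in
  let b := ln 2 - hw_mu0 p in
  let K := (2 * `|b| + b ^+ 2 + hw_sigma1 p * hw_sigma2 p / S) /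
           (2 * hw_sigma0 p) in
  0 < x -> x <= (ln y)^-1 -> y < t -> t <= 2 * y ->
  (Num.sqrt (2 * pi) * Num.sqrt S * (2 * y))^-1 *
    expR (- (ln y ^+ 2 / (2 * S) + K * ln y)) <= hw_fYX p t x.
Proof.
(* K is chosen so that sigma(x)^2 (L^2 / S + 2 K L) >= (L + b)^2, using
   sigma(x)^2 >= S - sigma1 sigma2 / L for the first summand and
   sigma(x)^2 >= sigma0 for the second. *)
move=> [_ [m10 m20] [s0 s1 s2] _ _] y0 L1 mL S b K x0 xL yt ty.
set L := ln y in L1 mL xL *.
have L0 : 0 < L by exact: lt_le_trans L1.
have t0 : 0 < t by exact: lt_trans yt.
have S0 : 0 < S by exact: addr_gt0.
have c0 : 0 < Num.sqrt (2 * pi) :> R by rewrite sqrtr_gt0 mulr_gt0// pi_gt0.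
have sg2 : 0 < hw_sigma p x ^+ 2.
  by rewrite (hw_sigma_sqr _ (ltW s0) (ltW s1)) addr_gt0 ?mulr_gt0 ?expR_gt0.
have sg : 0 < hw_sigma p x.
  by apply: lt_le_trans _ (hw_sigma_ge x (ltW s1)); rewrite sqrtr_gt0.
have sS : hw_sigma p x <= Num.sqrt S.
  rewrite ler_wsqrtr// lerD2l ler_piMr ?expR_le1//; first exact: ltW.
  by rewrite mulNr oppr_le0 mulr_ge0 ?ltW.
rewrite /hw_fYX /lognormal_pdf t0.
apply: ler_pM.
- by rewrite invr_ge0 !mulr_ge0 ?sqrtr_ge0// ltW.
- exact: expR_ge0.
- have d1 : 0 < Num.sqrt (2 * pi) * hw_sigma p x * t by rewrite !mulr_gt0.
  have d2 : 0 < Num.sqrt (2 * pi) * Num.sqrt S * (2 * y).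
    by rewrite !mulr_gt0// sqrtr_gt0.
  rewrite lef_pV2 ?posrE//.
  apply: ler_pM => //; first by rewrite mulr_ge0 ?sqrtr_ge0.
    exact: ltW.
  by rewrite ler_wpM2l// ltW.
rewrite ler_expR lerN2.
have x1 : x <= 1 by apply: le_trans xL _; rewrite invf_le1.
have mu1 : hw_mu0 p <= hw_mu p x by rewrite lerDl mulr_ge0 ?powR_ge0// ltW.
have mu2 : hw_mu p x <= hw_mu0 p + hw_mu1 p.
  rewrite lerD2l ler_piMr//; first exact: ltW.
  have -> : 1 = 1 `^ hw_mu2 p :> R by rewrite powR1.
  by rewrite ge0_ler_powR// ?nnegrE ltW.
have Lt : L <= ln t by rewrite ler_ln ?posrE// ltW.
have tL : ln t <= L + ln 2.
  by rewrite addrC -lnM ?posrE// ler_ln ?posrE// mulr_gt0.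
(* Here mu(x) <= mu0 + mu1 <= L <= ln t, so the difference is nonnegative and squaring preserves the
   upper bound L + ln 2 - mu0. *)
have num : (ln t - hw_mu p x) ^+ 2 <= (L + b) ^+ 2.
  rewrite ler_sqr ?nnegrE; rewrite /b; lra.
rewrite ler_pdivrMr; last by lra.
apply: le_trans num _.
have -> : (L ^+ 2 / (2 * S) + K * L) * (2 * hw_sigma p x ^+ 2) =
   hw_sigma p x ^+ 2 * (L ^+ 2 / S) + hw_sigma p x ^+ 2 * (2 * K * L).
  by field; rewrite gt_eqF.
have K0 : 0 <= K.
  apply: divr_ge0; last by rewrite pmulr_rge0// ltW.
  apply: addr_ge0; first by rewrite addr_ge0 ?sqr_ge0// mulr_ge0.
  by apply: divr_ge0; [rewrite mulr_ge0 ?ltW|exact: ltW].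
(* From exp(-s) >= 1 - s at s = sigma2 x, with x <= 1 / L. *)
have h1 : S - hw_sigma1 p * hw_sigma2 p / L <= hw_sigma p x ^+ 2.
  rewrite (hw_sigma_sqr _ (ltW s0) (ltW s1)).
  have := expR_ge1Dx (- hw_sigma2 p * x) => h.
  have := ler_wpM2l (ltW s1) h.
  have : hw_sigma1 p * hw_sigma2 p * x <= hw_sigma1 p * hw_sigma2 p / L.
    by rewrite ler_wpM2l// mulr_ge0 ?ltW.
  rewrite /S; lra.
have h2 : hw_sigma0 p <= hw_sigma p x ^+ 2.
  by rewrite (hw_sigma_sqr _ (ltW s0) (ltW s1)) lerDl mulr_ge0 ?expR_ge0// ltW.
have h3 := ler_wpM2r (divr_ge0 (sqr_ge0 L) (ltW S0)) h1.
have h4 : hw_sigma0 p * (2 * K * L) <= hw_sigma p x ^+ 2 * (2 * K * L).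
  apply: ler_wpM2r => //; apply: mulr_ge0; last exact: ltW.
  by apply: mulr_ge0.
have e3 : (S - hw_sigma1 p * hw_sigma2 p / L) * (L ^+ 2 / S) =
   L ^+ 2 - hw_sigma1 p * hw_sigma2 p / S * L.
  by field; rewrite !gt_eqF.
have e4 : hw_sigma0 p * (2 * K * L) =
    (2 * `|b| + b ^+ 2 + hw_sigma1 p * hw_sigma2 p / S) * L.
  by rewrite /K; field; rewrite !gt_eqF.
rewrite e3 in h3; rewrite e4 in h4.
apply: le_trans (lerD h3 h4).
have -> : L ^+ 2 - hw_sigma1 p * hw_sigma2 p / S * L +
    (2 * `|b| + b ^+ 2 + hw_sigma1 p * hw_sigma2 p / S) * L =
    L ^+ 2 + 2 * (`|b| * L) + b ^+ 2 * L by ring.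
have h5 : b ^+ 2 <= b ^+ 2 * L by rewrite ler_peMr ?sqr_ge0.
have h6 : b * L <= `|b| * L by rewrite ler_wpM2r ?ler_norm// ltW.
have -> : (L + b) ^+ 2 = L ^+ 2 + 2 * (b * L) + b ^+ 2 by ring.
lra.
Qed.

Lemma integral_ge_cst (d : measure_display) (T : measurableType d)
    (R : realType) (mu : {measure set T -> \bar R}) (D : set T)
    (c : R) (f : T -> \bar R) :
  measurable D -> 0 <= c -> (forall x, D x -> c%:E <= f x)%E ->
  (c%:E * mu D <= \int[mu]_(x in D) f x)%E.
Proof.
move=> mD c0 cf; rewrite -integral_cst//.
by apply: ge0_le_integral_nonmeasurable => x Dx; rewrite ?lee_fin ?cf.
Qed.

Lemma hw_survival_ge (R : realType) (d : measure_display)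
    (T : measurableType d) (P : probability T R) (X Y : {RV P >-> R})
    (p : hw_param R) :
  hw_admissible p -> follows_hw p X Y ->
  let S := hw_sigma0 p + hw_sigma1 p in
  exists C K T0 : R, 0 < C /\ forall y, 0 < y -> T0 <= ln y ->
   ((C * expR (- (ln y ^+ 2 / (2 * S) + K * ln y)))%:E <=
     P [set w | (y < Y w)%R])%E.
Proof.
move=> hp hXY S; have [hX hXYd] := hXY.
have [[u0 a0 k0 l0] [m10 m20] [s0 s1 s2] _ _] := hp.
have S0 : 0 < S by exact: addr_gt0.
have c0 : 0 < Num.sqrt (2 * pi) :> R by rewrite sqrtr_gt0 mulr_gt0// pi_gt0.
pose b := ln 2 - hw_mu0 p.
pose K1 := (2 * `|b| + b ^+ 2 + hw_sigma1 p * hw_sigma2 p / S) /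
           (2 * hw_sigma0 p).
(* The 2 in [cY] comes from t <= 2 y, the 2 in [cX] from the length 1 / (2 L) of the window for
   X. *)
pose cY := (Num.sqrt (2 * pi) * Num.sqrt S * 2)^-1.
pose cX := (Num.sqrt (2 * pi) * hw_alpha p * 2)^-1.
have cY0 : 0 < cY by rewrite invr_gt0 !mulr_gt0// sqrtr_gt0.
have cX0 : 0 < cX by rewrite invr_gt0 !mulr_gt0.
(* The term 8 / alpha^2 is the linear loss from the density of X. The threshold forces L >= 1, 1 / L
   <= u and mu0 + mu1 <= L. *)
exists (cX * cY * expR (- (hw_theta p ^+ 2 / hw_alpha p ^+ 2))),
  (K1 + 8 / hw_alpha p ^+ 2),
  (1 + (hw_u p)^-1 + `|hw_mu0 p + hw_mu1 p|).
split; first by rewrite !mulr_gt0// expR_gt0.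
move=> y y0; set L := ln y => TL.
have ui : 0 < (hw_u p)^-1 by rewrite invr_gt0.
have nn := normr_ge0 (hw_mu0 p + hw_mu1 p).
have mn := ler_norm (hw_mu0 p + hw_mu1 p).
have L1 : 1 <= L by lra.
have uL : (hw_u p)^-1 <= L by lra.
have mL : hw_mu0 p + hw_mu1 p <= L by lra.
have L0 : 0 < L by lra.
have Lu : L^-1 <= hw_u p by rewrite -[leRHS]invrK lef_pV2 ?posrE.
pose A := `](2 * L)^-1, L^-1]%classic : set R.
pose B := `]y, 2 * y]%classic : set R.
have mA : measurable (X @^-1` A).
  rewrite -[X in measurable X]setTI; apply: measurable_funPT => //.
  exact: measurable_itv.
have mB : measurable (Y @^-1` B).
  rewrite -[X in measurable X]setTI; apply: measurable_funPT => //.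
  exact: measurable_itv.
have mY : measurable [set w | y < Y w].
  rewrite (_ : [set w | _] = Y @^-1` `]y, +oo[).
    rewrite -[X in measurable X]setTI; apply: measurable_funPT => //.
  by apply/seteqP; split=> w; rewrite /= in_itv/= andbT.
apply: le_trans (_ : P (X @^-1` A `&` Y @^-1` B) <= _)%E; last first.
  apply: le_measure; rewrite ?inE//; first exact: measurableI.
  by move=> w [_]; rewrite /B /= in_itv/= => /andP[].
rewrite hXYd; [|exact: measurable_itv|exact: measurable_itv].
(* [g] bounds the conditional probability of y < Y <= 2 y on the window; [f] bounds the density of X
   there. *)
pose g := cY * expR (- (L ^+ 2 / (2 * S) + K1 * L)).
have g0 : 0 <= g by rewrite mulr_ge0 ?expR_ge0// ltW.
pose f := cX * 2 * L * expR (- ((8 * L + hw_theta p ^+ 2) / hw_alpha p ^+ 2)).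
have f0 : 0 <= f by rewrite !mulr_ge0 ?expR_ge0// ltW.
have fA : ((f * (2 * L)^-1)%:E <= distribution P X A)%E.
  rewrite hX; last exact: measurable_itv.
  have -> : ((f * (2 * L)^-1)%:E = f%:E * lebesgue_measure A)%E.
    rewrite lebesgue_measure_itv/= lte_fin ltf_pV2 ?posrE ?mulr_gt0//.
    rewrite ltr_pMl// ltr1n -EFinD -EFinM; congr (_ * _)%:E.
    by field; rewrite gt_eqF.
  apply: integral_ge_cst => //; first exact: measurable_itv.
  move=> x; rewrite /A /= in_itv/= => /andP[x1 x2]; rewrite lee_fin.
  apply: le_trans (hw_fX_ge a0 L1 Lu x1 x2).
  apply: ler_wpM2r; first exact: expR_ge0.
  apply: ler_wpM2r; first exact: ltW.
  rewrite le_eqVlt; apply/orP; left; apply/eqP.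
  by rewrite /cX; field; rewrite !gt_eqF.
have gB x : A x ->
    (g%:E <= \int[lebesgue_measure]_(t in B) (hw_fYX p t x)%:E)%E.
  rewrite /A /= in_itv/= => /andP[x1 x2].
  have x0 : 0 < x by apply: lt_trans x1; rewrite invr_gt0 mulr_gt0.
  have -> : (g%:E = (g / y)%:E * lebesgue_measure B)%E.
    rewrite lebesgue_measure_itv/= lte_fin ltr_pMl// ltr1n -EFinD -EFinM.
    by congr (_%:E); field; rewrite gt_eqF.
  apply: integral_ge_cst => //; first exact: measurable_itv.
    by rewrite divr_ge0// ltW.
  move=> t; rewrite /B /= in_itv/= => /andP[t1 t2]; rewrite lee_fin.
  apply: le_trans (hw_fYX_ge hp y0 L1 mL x0 x2 t1 t2).
  rewrite /g -/S -/b -/K1 -/L mulrAC ler_wpM2r ?expR_ge0//.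
  rewrite le_eqVlt; apply/orP; left; apply/eqP.
  by rewrite /cY; field; rewrite !gt_eqF// sqrtr_gt0.
apply: le_trans (_ : g%:E * distribution P X A <= _)%E; last first.
  by apply: integral_ge_cst => //; exact: measurable_itv.
apply: le_trans (lee_wpmul2l _ fA); last by rewrite lee_fin.
rewrite -EFinM lee_fin le_eqVlt; apply/orP; left; apply/eqP.
(* Splitting the exponents exposes the same three exponentials on both sides and leaves a rational
   identity. *)
have -> : - (L ^+ 2 / (2 * S) + (K1 + 8 / hw_alpha p ^+ 2) * L) =
  - (L ^+ 2 / (2 * S) + K1 * L) - 8 * L / hw_alpha p ^+ 2 by ring.
rewrite /g /f.
have -> : - ((8 * L + hw_theta p ^+ 2) / hw_alpha p ^+ 2) =
  - (hw_theta p ^+ 2 / hw_alpha p ^+ 2) - 8 * L / hw_alpha p ^+ 2 by ring.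
rewrite !(expRD _ (- (8 * L / _))).
by field; rewrite gt_eqF.
Qed.

(** * From two-sided bounds to the logarithmic error term *)

(** Recentring the square costs only the cross term b L / S; the remaining term -b^2 / (2 S) has the
    favourable sign. *)
Lemma neg_sqr_shift_le (R : realType) (L b S : R) : 0 <= L -> 0 < S ->
  - ((L - b) ^+ 2 / (2 * S)) <= - (L ^+ 2 / (2 * S)) + `|b| / S * L.
Proof.
move=> L0 S0; rewrite -subr_ge0.
have -> : - (L ^+ 2 / (2 * S)) + `|b| / S * L - - ((L - b) ^+ 2 / (2 * S)) =
  (2 * ((`|b| - b) * L) + b ^+ 2) / (2 * S) by field; rewrite gt_eqF.
apply: divr_ge0; last by rewrite pmulr_rge0// ltW.
by rewrite addr_ge0 ?sqr_ge0// !mulr_ge0// subr_ge0 ler_norm.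
Qed.

Theorem mainTheorem3 (R : realType) (d : measure_display) (T : measurableType d)
    (P : probability T R) (X Y : {RV P >-> R}) (p : hw_param R)
    (hp : hw_admissible p) (hXY : follows_hw p X Y)
    (hmu2 : 0 < hw_mu2 p < 1 / 2) (hk : 2 * hw_mu2 p < hw_k p) :
  exists2 E : R -> R,
    E =O_ (+oo_R) (@ln R) &
    \forall y \near +oo_R,
      P [set w | y < Y w] =
        (expR (- ((ln y) ^+ 2 / (2 * (hw_sigma0 p + hw_sigma1 p))) + E y))%:E.
Proof.
have [_ _ [s0 s1 s2] _ _] := hp.
have [C [b1 [b2 [C0 up]]]] := hw_survival_le hp hXY hk.
have [c [K [T0 [c0 low]]]] := hw_survival_ge hp hXY.
set S := hw_sigma0 p + hw_sigma1 p in up low *.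
have S0 : 0 < S by exact: addr_gt0.
pose pr (y : R) : R := fine (P [set w | y < Y w]).
have prE y : P [set w | y < Y w] = (pr y)%:E.
  rewrite /pr fineK// fin_num_measure//.
  rewrite (_ : [set w | _] = Y @^-1` `]y, +oo[).
    by rewrite -[X in measurable X]setTI; apply: measurable_funPT.
  by apply/seteqP; split=> w; rewrite /= in_itv/= andbT.
(* One threshold for all conditions on ln y; T0 <= 1 + T0^2 whatever the sign of T0. *)
pose M := 1 + T0 ^+ 2 + `|b1| + `|b2|.
have big (y : R) : expR M < y ->
    [/\ 0 < y, 1 <= ln y, T0 <= ln y, b1 <= ln y & b2 <= ln y].
  move=> My; have y0 : 0 < y := lt_trans (expR_gt0 _) My.
  have ML : M < ln y by rewrite -[M]expRK ltr_ln ?posrE ?expR_gt0.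
  have := ler_norm b1; have := ler_norm b2; have := normr_ge0 b1.
  have := normr_ge0 b2; have := sqr_ge0 T0; have := sqr_ge0 (T0 - 1).
  by rewrite /M in ML; split=> //; nra.
have lowE y : expR M < y ->
    c * expR (- (ln y ^+ 2 / (2 * S) + K * ln y)) <= pr y.
  by move=> /big[y0 _ TL _ _]; rewrite -lee_fin -prE; exact: low.
have pr0 y : expR M < y -> 0 < pr y.
  by move=> /lowE; apply: lt_le_trans; rewrite mulr_gt0 ?expR_gt0.
(* The error is obtained by solving the identity for it; the lower bound makes [pr y] positive, so
   [ln] inverts [expR] there. *)
exists (fun y => ln (pr y) + ln y ^+ 2 / (2 * S)); last first.
  exists (expR M); split; first exact: num_real.
  by move=> y My; rewrite prE addrC addrK lnK// posrE pr0.
pose B := (`|b1| + `|b2|) / S.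
have B0 : 0 <= B by rewrite divr_ge0 ?addr_ge0// ltW.
(* Collects the constants of both bounds; those without a factor L are absorbed because L >= 1. The
   big-O constant [k + 1] is then strictly positive. *)
pose k := `|ln c| + `|K| + `|ln (2 * (C + 1))| + B.
apply/eqO_exP; exists (k + 1).
  by rewrite ltr_wpDl ?addr_ge0.
exists (expR M); split; first exact: num_real.
move=> y My; have [y0 L1 TL bL1 bL2] := big _ My.
set L := ln y in L1 TL bL1 bL2 *.
have L0 : 0 <= L by lra.
rewrite (ger0_norm L0).
have kL : k * L <= (k + 1) * L by rewrite ler_wpM2r// lerDl.
apply: le_trans kL.
have n1 : `|ln c| <= `|ln c| * L by rewrite ler_peMr.
have n2 : `|K| * L >= K * L by rewrite ler_wpM2r// ler_norm.
have n3 : `|ln (2 * (C + 1))| <= `|ln (2 * (C + 1))| * L by rewrite ler_peMr.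
have n4 : 0 <= B * L by rewrite mulr_ge0.
have n5 : 0 <= `|K| * L by rewrite mulr_ge0.
have n6 : - ln c <= `|ln c| by rewrite -normrN ler_norm.
have n7 := ler_norm (ln (2 * (C + 1))).
have n8 : 0 <= `|ln c| by [].
have n9 : 0 <= `|ln (2 * (C + 1))| by [].
rewrite ler_norml; apply/andP; split.
  have : ln (c * expR (- (L ^+ 2 / (2 * S) + K * L))) <= ln (pr y).
    by rewrite ler_ln ?posrE ?pr0 ?mulr_gt0 ?expR_gt0// lowE.
  rewrite lnM ?posrE ?expR_gt0// expRK /k.
  set Q := L ^+ 2 / _; lra.
(* [C] may be zero, so it is raised to [C + 1] before taking logarithms. *)
have : pr y <= 2 * (C + 1) * expR (- (L ^+ 2 / (2 * S)) + B * L).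
  have := up _ y0 bL1 bL2; rewrite prE -EFinD lee_fin; move/le_trans; apply.
  have bnd b : `|b| <= `|b1| + `|b2| ->
      C * expR (- ((L - b) ^+ 2 / (2 * S))) <=
      (C + 1) * expR (- (L ^+ 2 / (2 * S)) + B * L).
    move=> bb; apply: ler_pM => //; first by rewrite lerDl.
    rewrite ler_expR; apply: le_trans (neg_sqr_shift_le b L0 S0) _.
    by rewrite lerD2l ler_wpM2r// ler_wpM2r// invr_ge0 ltW.
  set e := expR (_ + B * L) in bnd *.
  have -> : 2 * (C + 1) * e = (C + 1) * e + (C + 1) * e by ring.
  by apply: lerD; apply: bnd; rewrite ?lerDl ?lerDr.
rewrite -ler_ln ?posrE ?pr0 ?mulr_gt0 ?expR_gt0//; last by lra.
rewrite lnM ?posrE ?expR_gt0// ?mulr_gt0 ?expRK; [|lra..].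
rewrite /k; set Q := L ^+ 2 / _; lra.
Qed.
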